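(* Let $n$ be a positive integer and $\pi\in S_n$. Then there exists an indecomposable Frobenius ring with a Nakayama permutation $\pi$.
   Context: Rings are associative and unital; $J(R)$ is the Jacobson radical; $S_n$ is the symmetric group on $\{1,\dots,n\}$. A ring is semiperfect if its unity is a finite sum of pairwise orthogonal local idempotents ($e$ is local if $eRe$ is a local ring). A basic set of idempotents of a semiperfect ring $R$ is a set $e_1,\dots,e_n$ of pairwise orthogonal local idempotents such that $e_1R,\dots,e_nR$ are pairwise non-isomorphic and represent all indecomposable finitely generated projective right $R$-modules up to isomorphism; its multiplicities are the positive integers $\mu_1,\dots,\mu_n$ with $R_R\cong(e_1R)^{\mu_1}\oplus\dots\oplus(e_nR)^{\mu_n}$. $R$ is a ring with a Nakayama permutation $\pi\in S_n$ if, for a basic set of idempotents $e_1,\dots,e_n$, one has for each $i\le n$: $soc(e_iR)\cong top(e_{\pi(i)}R)$ as right modules and $soc(Re_{\pi(i)})\cong top(Re_i)$ as left modules, where $top(M)=M/MJ(R)$ (resp. $M/J(R)M$). A ring is QF if it is (left and right) artinian with a Nakayama permutation $\pi$; it is Frobenius if, furthermore, $\mu_i=\mu_{\pi(i)}$ for each $i\le n$. A ring is indecomposable if it is not a direct product of two nonzero rings. *)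

(* Defs.v *)
From HB Require Import structures.
From mathcomp Require Import all_boot all_order all_algebra all_fingroup.
From mathcomp Require Import generic_quotient ring_quotient boolp.

Set Implicit Arguments.
Unset Strict Implicit.
Unset Printing Implicit Defensive.

Import GRing.Theory.

Local Open Scope ring_scope.
Local Open Scope quotient_scope.

(* A left S-module is an M : lmodType S; a right R-module is a left module    *)
(* over the converse ring, i.e. an M : lmodType R^c.  A submodule of M is an  *)
(* N : submodClosed M; boolean-valued membership is no restriction, since     *)
(* every proposition P is reflected by `[< P >] (boolp).                      *)

(* The submodule N of M, as a module.                                         *)
Section SubModule.
Variables (S : pzRingType) (M : lmodType S) (N : submodClosed M).

Record submod := Submod { submod_val : M; _ : submod_val \in N }.

HB.instance Definition _ := [isSub for submod_val].
HB.instance Definition _ := [Choice of submod by <:].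
HB.instance Definition _ := [SubChoice_isSubLmodule of submod by <:].

End SubModule.

(* The quotient module M / N: the library's quotient of the additive group,   *)
(* with the induced scaling.                                                  *)
Section QuotientModule.
Variables (S : pzRingType) (M : lmodType S) (N : submodClosed M).

(* N is only known to be closed under addition and scaling; closure under     *)
(* opposites is added here.                                                   *)
Definition submod_pred : {pred M} := N.

Lemma submod_pred_zmod_closed : zmod_closed submod_pred.
Proof. exact/GRing.submod_closedB/submodClosedP. Qed.

HB.instance Definition _ :=
  GRing.isZmodClosed.Build M submod_pred submod_pred_zmod_closed.

Definition quotmod : Type := Quotient.quot submod_pred.

HB.instance Definition _ := GRing.Zmodule.on quotmod.
HB.instance Definition _ := Quotient.on quotmod.

Definition quotmod_scale (a : S) (x : quotmod) : quotmod :=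
  \pi_quotmod (a *: repr x).

Lemma quotmod_eqP (x y : M) :
  reflect (\pi_quotmod x = \pi_quotmod y) (x - y \in N).
Proof. by rewrite (Quotient.idealrBE submod_pred); exact: eqP. Qed.

Lemma quotmod_surj (v : quotmod) : exists x : M, v = \pi_quotmod x.
Proof. by exists (repr v); rewrite reprK. Qed.

Lemma pi_quotmodB (x y : M) :
  \pi_quotmod (x - y) = \pi_quotmod x - \pi_quotmod y.
Proof. exact: (raddfB (\pi_(Quotient.quot submod_pred))). Qed.

Lemma pi_quotmodD (x y : M) :
  \pi_quotmod (x + y) = \pi_quotmod x + \pi_quotmod y.
Proof. exact: (raddfD (\pi_(Quotient.quot submod_pred))). Qed.

Lemma pi_quotmodZ (a : S) (x : M) :
  quotmod_scale a (\pi_quotmod x) = \pi_quotmod (a *: x).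
Proof.
apply/quotmod_eqP; rewrite -scalerBr; apply: rpredZ.
by apply/quotmod_eqP; rewrite reprK.
Qed.

Lemma quotmod_scaleA a b v :
  quotmod_scale a (quotmod_scale b v) = quotmod_scale (a * b) v.
Proof. by case: (quotmod_surj v) => x ->; rewrite !pi_quotmodZ scalerA. Qed.

Lemma quotmod_scale1 : left_id 1 quotmod_scale.
Proof. by move=> v; case: (quotmod_surj v) => x ->; rewrite pi_quotmodZ scale1r. Qed.

Lemma quotmod_scaleDr : right_distributive quotmod_scale +%R.
Proof.
move=> a u v; case: (quotmod_surj u) (quotmod_surj v) => x -> [y ->].
by rewrite -pi_quotmodD !pi_quotmodZ -pi_quotmodD scalerDr.
Qed.

Lemma quotmod_scaleDl v : {morph quotmod_scale^~ v : a b / a + b}.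
Proof.
by move=> a b; case: (quotmod_surj v) => x ->; rewrite !pi_quotmodZ -pi_quotmodD scalerDl.
Qed.

HB.instance Definition _ := GRing.Zmodule_isLmodule.Build S quotmod
  quotmod_scaleA quotmod_scale1 quotmod_scaleDr quotmod_scaleDl.

End QuotientModule.

(* The external direct sum of a finite family of modules.                     *)
Section DirectSum.
Variables (S : pzRingType) (I : finType) (M : I -> lmodType S).

Definition dsum : Type := {dffun forall i : I, M i}.

HB.instance Definition _ := Choice.on dsum.

Implicit Types f g h : dsum.

Definition dsum_zero : dsum := [ffun i : I => (0 : M i)].
Definition dsum_opp f : dsum := [ffun i : I => - f i].
Definition dsum_add f g : dsum := [ffun i : I => f i + g i].
Definition dsum_scale (a : S) f : dsum := [ffun i : I => a *: f i].

Lemma dsum_addA : associative dsum_add.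
Proof. by move=> f g h; apply/ffunP => i; rewrite !ffunE addrA. Qed.
Lemma dsum_addC : commutative dsum_add.
Proof. by move=> f g; apply/ffunP => i; rewrite !ffunE addrC. Qed.
Lemma dsum_add0 : left_id dsum_zero dsum_add.
Proof. by move=> f; apply/ffunP => i; rewrite !ffunE add0r. Qed.
Lemma dsum_addN : left_inverse dsum_zero dsum_opp dsum_add.
Proof. by move=> f; apply/ffunP => i; rewrite !ffunE addNr. Qed.

HB.instance Definition _ :=
  GRing.isZmodule.Build dsum dsum_addA dsum_addC dsum_add0 dsum_addN.

Lemma dsum_scaleA a b f :
  dsum_scale a (dsum_scale b f) = dsum_scale (a * b) f.
Proof. by apply/ffunP => i; rewrite !ffunE scalerA. Qed.
Lemma dsum_scale1 : left_id 1 dsum_scale.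
Proof. by move=> f; apply/ffunP => i; rewrite !ffunE scale1r. Qed.
Lemma dsum_scaleDr : right_distributive dsum_scale +%R.
Proof. by move=> a f g; apply/ffunP => i; rewrite !ffunE scalerDr. Qed.
Lemma dsum_scaleDl f : {morph dsum_scale^~ f : a b / a + b}.
Proof. by move=> a b; apply/ffunP => i; rewrite !ffunE scalerDl. Qed.

HB.instance Definition _ := GRing.Zmodule_isLmodule.Build S dsum
  dsum_scaleA dsum_scale1 dsum_scaleDr dsum_scaleDl.

End DirectSum.

Section SpanCyclic.
Variables (S : pzRingType) (M : lmodType S).

(* The submodule generated by a subset A of M.                                *)
Definition span (A : M -> Prop) : {pred M} := fun x =>
  `[< forall K : submodClosed M, (forall y, A y -> y \in K) -> x \in K >].

Lemma span_submod_closed A : submod_closed (span A).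
Proof.
split; first by apply/asboolP => K _; exact: rpred0.
move=> a x y /asboolP xA /asboolP yA; apply/asboolP => K AK.
by rewrite rpredD ?rpredZ ?xA ?yA.
Qed.

HB.instance Definition _ A :=
  GRing.isSubmodClosed.Build S M (span A) (span_submod_closed A).

Definition cyclic_submod (v : M) : {pred M} := fun x =>
  `[< exists a : S, x = a *: v >].

Lemma cyclic_submod_closed v : submod_closed (cyclic_submod v).
Proof.
split; first by apply/asboolP; exists 0; rewrite scale0r.
move=> a _ _ /asboolP[b ->] /asboolP[c ->]; apply/asboolP.
by exists (a * b + c); rewrite scalerDl scalerA.
Qed.

HB.instance Definition _ v :=
  GRing.isSubmodClosed.Build S M (cyclic_submod v) (cyclic_submod_closed v).

End SpanCyclic.

Section ModuleNotions.
Variable S : pzRingType.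

Definition mod_iso (M N : lmodType S) : Prop :=
  exists f : {linear M -> N}, bijective f.

Definition simple_submod (M : lmodType S) (N : submodClosed M) : Prop :=
  ~ (N =i pred1 0) /\
  (forall K : submodClosed M, {subset K <= N} -> K =i pred1 0 \/ K =i N).

Definition maximal_submod (M : lmodType S) (N : submodClosed M) : Prop :=
  ~ (N =i predT) /\
  (forall K : submodClosed M, {subset N <= K} -> K =i N \/ K =i predT).

(* The sum of all simple submodules.                                          *)
Definition soc (M : lmodType S) : lmodType S :=
  submod (span (fun x : M =>
    exists N : submodClosed M, simple_submod N /\ x \in N)).

(* M / IM, for a subset I of S.                                               *)
Definition quot_by (I : S -> Prop) (M : lmodType S) : lmodType S :=
  quotmod (span (fun x : M => exists a y, I a /\ x = a *: y)).

Definition artinian (M : lmodType S) : Prop :=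
  forall N : nat -> submodClosed M,
    (forall k, {subset N k.+1 <= N k}) ->
    exists k, forall m, (k <= m)%N -> N m =i N k.

Definition fin_gen (M : lmodType S) : Prop :=
  exists (k : nat) (v : 'I_k -> M),
    forall x, exists c : 'I_k -> S, x = \sum_(i < k) c i *: v i.

Definition projective (P : lmodType S) : Prop :=
  forall (A B : lmodType S) (f : {linear A -> B}) (g : {linear P -> B}),
    (forall b, exists a, f a = b) ->
    exists h : {linear P -> A}, forall x, f (h x) = g x.

Definition indecomposable_mod (M : lmodType S) : Prop :=
  (exists x : M, x != 0) /\
  (forall A B : submodClosed M,
     (forall x, exists a b, [/\ a \in A, b \in B & x = a + b]) ->
     (forall x, x \in A -> x \in B -> x = 0) ->
     A =i pred1 0 \/ B =i pred1 0).

End ModuleNotions.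

(* A ring with exactly one maximal left ideal.                                *)
Definition local_ring (S : pzRingType) : Prop :=
  exists m : submodClosed (S^o : lmodType S),
    maximal_submod m /\
    (forall m' : submodClosed (S^o : lmodType S),
       maximal_submod m' -> m' =i m).

(* The corner ring eRe, with unity e.                                         *)
Section Corner.
Variables (R : pzRingType) (e : R).

Definition in_corner : {pred R} := fun x => e * x * e == x.

Lemma in_corner_zmod_closed : zmod_closed in_corner.
Proof.
split; first by rewrite /in_corner unfold_in mulr0 mul0r.
move=> x y; rewrite !unfold_in => /eqP ex /eqP ey.
by rewrite mulrBr mulrBl ex ey.
Qed.

HB.instance Definition _ :=
  GRing.isZmodClosed.Build R in_corner in_corner_zmod_closed.

(* The idempotence proof is a parameter because the ring structure needs it.  *)
Record corner (idem_e : e * e = e) :=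
  Corner { corner_val : R; _ : corner_val \in in_corner }.

Variable idem_e : e * e = e.
Local Notation eRe := (corner idem_e).

HB.instance Definition _ := [isSub of eRe for @corner_val idem_e].
HB.instance Definition _ := [Choice of eRe by <:].
HB.instance Definition _ := [SubChoice_isSubZmodule of eRe by <:].

Lemma corner_valP (x : eRe) : e * val x * e = val x.
Proof. exact/eqP/(valP x). Qed.

Lemma corner_mull (x : eRe) : e * val x = val x.
Proof. by rewrite -[val x]corner_valP !mulrA idem_e. Qed.

Lemma corner_mulr (x : eRe) : val x * e = val x.
Proof. by rewrite -[val x]corner_valP -!mulrA idem_e. Qed.

Lemma corner_one_subproof : e \in in_corner.
Proof. by rewrite unfold_in !idem_e. Qed.

Lemma corner_mul_subproof (x y : eRe) : val x * val y \in in_corner.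
Proof. by rewrite unfold_in mulrA corner_mull -mulrA corner_mulr. Qed.

Definition corner_one : eRe := Corner idem_e corner_one_subproof.
Definition corner_mul (x y : eRe) : eRe :=
  Corner idem_e (corner_mul_subproof x y).

Lemma corner_mulA : associative corner_mul.
Proof. by move=> x y z; apply: val_inj; rewrite /= mulrA. Qed.
Lemma corner_mul1 : left_id corner_one corner_mul.
Proof. by move=> x; apply: val_inj; exact: corner_mull. Qed.
Lemma corner_mulr1 : right_id corner_one corner_mul.
Proof. by move=> x; apply: val_inj; exact: corner_mulr. Qed.
Lemma corner_mulDl : left_distributive corner_mul +%R.
Proof. by move=> x y z; apply: val_inj; rewrite /= mulrDl. Qed.
Lemma corner_mulDr : right_distributive corner_mul +%R.
Proof. by move=> x y z; apply: val_inj; rewrite /= mulrDr. Qed.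

HB.instance Definition _ := GRing.Zmodule_isPzRing.Build eRe
  corner_mulA corner_mul1 corner_mulr1 corner_mulDl corner_mulDr.

End Corner.

Section RingNotions.
Variable R : pzRingType.

Definition left_reg : lmodType R := R^o.
Definition right_reg : lmodType R^c := (R^c)^o.

(* The left module Re and the right module eR.                                *)
Definition left_pim (e : R) : lmodType R :=
  submod (cyclic_submod (e : left_reg)).
Definition right_pim (e : R) : lmodType R^c :=
  submod (cyclic_submod (e : right_reg)).

(* J(R), the intersection of all maximal right ideals; by left-right symmetry *)
(* of the radical the same J(R) serves for left modules.                      *)
Definition jacobson (x : R) : Prop :=
  forall m : submodClosed right_reg, maximal_submod m -> (x : right_reg) \in m.

(* M / J(R)M for a left module, M / MJ(R) for a right module.                 *)
Definition left_top (M : lmodType R) : lmodType R := quot_by jacobson M.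
Definition right_top (M : lmodType R^c) : lmodType R^c :=
  @quot_by R^c jacobson M.

Definition local_idempotent (e : R) : Prop :=
  exists idem_e : e * e = e, local_ring (corner idem_e).

Definition orthogonal_family (n : nat) (e : 'I_n -> R) : Prop :=
  forall i j, i != j -> e i * e j = 0.

Definition semiperfect : Prop :=
  exists (k : nat) (e : 'I_k -> R),
    [/\ forall i, local_idempotent (e i), orthogonal_family e
      & \sum_(i < k) e i = 1].

Definition left_artinian : Prop := artinian left_reg.
Definition right_artinian : Prop := artinian right_reg.

Definition indecomposable_ring : Prop :=
  ~ exists (A B : nzRingType) (f : {rmorphism R -> (A * B)%type}), bijective f.

Variable n : nat.

Definition basic_set (e : 'I_n -> R) : Prop :=
  [/\ forall i, local_idempotent (e i),
      orthogonal_family e,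
      forall i j, i != j -> ~ mod_iso (right_pim (e i)) (right_pim (e j))
    & forall P : lmodType R^c,
        fin_gen P -> projective P -> indecomposable_mod P ->
        exists i, mod_iso P (right_pim (e i))].

Definition multiplicities (e : 'I_n -> R) (mu : 'I_n -> nat) : Prop :=
  (forall i, (0 < mu i)%N) /\
  mod_iso right_reg
    (dsum (fun i => dsum (fun _ : 'I_(mu i) => right_pim (e i)))).

Definition nakayama (e : 'I_n -> R) (pi : 'S_n) : Prop :=
  forall i,
    mod_iso (soc (right_pim (e i))) (right_top (right_pim (e (pi i)))) /\
    mod_iso (soc (left_pim (e (pi i)))) (left_top (left_pim (e i))).

(* R is QF, resp. Frobenius, with Nakayama permutation pi, as witnessed by    *)
(* the basic set e.                                                           *)
Definition QF_on (e : 'I_n -> R) (pi : 'S_n) : Prop :=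
  [/\ left_artinian, right_artinian, semiperfect, basic_set e
    & nakayama e pi].

Definition Frobenius_on (e : 'I_n -> R) (pi : 'S_n) : Prop :=
  QF_on e pi /\
  exists mu : 'I_n -> nat,
    multiplicities e mu /\ (forall i, mu i = mu (pi i)).

Definition Frobenius_with (pi : 'S_n) : Prop :=
  exists e : 'I_n -> R, Frobenius_on e pi.

End RingNotions.

(* Main.v *)
From HB Require Import structures.
Require Import Defs.
From mathcomp Require Import all_boot all_order all_algebra all_fingroup.
From mathcomp Require Import boolp.

Set Implicit Arguments.
Unset Strict Implicit.
Unset Printing Implicit Defensive.

(** The ring is the path algebra, over a finite field k, of the complete quiver
    on the vertices 1, ..., n (one arrow i -> j for every pair, loops included),
    modulo the relations making every path of length three zero and giving a
    path i -> j -> l of length two the value s_i if l = pi(i), and 0 otherwise.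
    So e_iR has a basis e_i, (a_ij)_j, s_i, where s_i lies in e_iRe_pi(i).

    Since every arrow i -> j is completed to s_i by exactly one arrow, namely
    j -> pi(i), the pairing of arrows is perfect, and every nonzero element of
    e_iR has s_i as a right multiple: the socle of e_iR is the line of s_i, on
    which R acts on the right through the vertex pi(i), that is, the socle is
    the top of e_pi(i)R.  On the other side s_i spans the socle of Re_pi(i), and
    R acts on it on the left through the vertex i (socle_essential_right,
    socle_essential_left).  The algebra is basic, so all multiplicities are 1
    and the Frobenius condition on them holds trivially; it is indecomposable
    because all vertices are connected by arrows; it is artinian because it is
    finite.

    The facts on tops, local idempotents and projective modules hold for any
    ring whose radical J has cube zero, and whose unity is a sum of orthogonal
    idempotents e_i mapped to the coordinate idempotents by an isomorphism of
    R/J with k^n.  These rings are described by the left-right symmetric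
    structure split_basic, so that each fact is proved once, for left modules,
    and obtained for right modules by passing to the converse ring.  The
    isomorphisms of simple modules come from one remark (cyclic_on_iso): two
    cyclic modules whose generators have the same annihilator are isomorphic.
    That the e_iR exhaust the indecomposable finitely generated projectives
    (proj_indec_pim) is shown with dual bases: some coordinate function of such
    a P must take a value outside J, and it makes some e_iR a direct summand
    of P. *)

Import GRing.Theory.
Local Open Scope ring_scope.
Local Open Scope quotient_scope.

(** * Modules *)

Section Modules.
Variable S : pzRingType.
Implicit Types M N : lmodType S.

(** Turns a proof of linearity into a bundled linear map. *)
Lemma linear_witness M N (f : M -> N) :
  linear f -> exists g : {linear M -> N}, g =1 f.
Proof.
move=> lin_f.
pose g : {linear M -> N} := HB.pack f (GRing.isLinear.Build S M N *:%R f lin_f).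
by exists g.
Qed.

Lemma submod_witness M (P : M -> Prop) :
    P 0 -> (forall a x y, P x -> P y -> P (a *: x + y)) ->
  exists N : submodClosed M, forall x, (x \in N) <-> P x.
Proof.
move=> P0 PD; pose A : {pred M} := fun x => `[< P x >].
have cA : submod_closed A.
  split; first exact/asboolP.
  by move=> a x y /asboolP Px /asboolP Py; apply/asboolP/PD.
pose N : submodClosed M := HB.pack A (GRing.isSubmodClosed.Build S M A cA).
exists N => x.
by split=> /asboolP.
Qed.

Lemma mod_iso_linear M N (f : M -> N) :
  linear f -> bijective f -> mod_iso M N.
Proof.
move=> /linear_witness[g gf] bij_f; exists g.
exact: eq_bij bij_f _ (fsym gf).
Qed.

Lemma mem_span M (A : M -> Prop) x : A x -> x \in Defs.span A.
Proof. by move=> Ax; apply/asboolP => K; exact. Qed.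

Lemma span_min M (A : M -> Prop) (P : M -> Prop) x :
    x \in Defs.span A ->
    P 0 -> (forall a y z, P y -> P z -> P (a *: y + z)) ->
  (forall y, A y -> P y) -> P x.
Proof.
move=> /asboolP xA P0 PD AP; have [K KP] := submod_witness P0 PD.
by apply/KP/xA => y Ay; apply/KP/AP.
Qed.

(** A module with this property is a copy of S / ann. *)
Definition cyclic_on M (v : M) (ann : S -> Prop) : Prop :=
  (forall x, exists a, x = a *: v) /\ (forall a, a *: v = 0 <-> ann a).

(** Both modules are the quotient of S by the common annihilator: [a *: v]
    corresponds to [a *: w], whichever scalar [a] is chosen. *)
Lemma cyclic_on_iso M N (v : M) (w : N) ann :
  cyclic_on v ann -> cyclic_on w ann -> mod_iso M N.
Proof.
move=> [genM annM] [genN annN].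
have eq_vw a b : a *: v = b *: v <-> a *: w = b *: w.
  rewrite (rwP eqP) -subr_eq0 -scalerBl -(rwP eqP) annM -annN.
  by rewrite scalerBl (rwP eqP) subr_eq0 -(rwP eqP).
have [f fv] := choice genM; have [g gw] := choice genN.
apply: (@mod_iso_linear _ _ (fun x => f x *: w)).
  move=> a x y; rewrite scalerA -scalerDl; apply/eq_vw.
  by rewrite -fv scalerDl -scalerA -!fv.
exists (fun y => g y *: v) => [x | y].
  by rewrite [RHS]fv; apply/eq_vw; rewrite -gw.
by rewrite [RHS]gw; apply/eq_vw; rewrite -fv.
Qed.

(** The hypothesis puts [v] in every nonzero submodule.  Hence the submodule
    generated by [v] is the only simple one, so it is the whole socle. *)
Lemma soc_cyclic M (v : M) :
    v != 0 -> (forall x, x != 0 -> exists a, v = a *: x) ->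
  exists w : soc M, cyclic_on w (fun a => a *: v = 0).
Proof.
move=> v_neq0 v_ess.
have v_in (K : submodClosed M) x : x \in K -> x != 0 -> v \in K.
  by move=> Kx /v_ess[a ->]; exact: rpredZ.
have mem_v a : a *: v \in cyclic_submod v by apply/asboolP; exists a.
have simple_v : simple_submod (cyclic_submod v : submodClosed M).
  split=> [v0 | K Kv].
    by have := mem_v 1; rewrite v0 scale1r inE (negPf v_neq0).
  have [K0 | /existsNP[x /not_implyP[Kx /eqP x0]]] :=
      pselect (forall x, x \in K -> x = 0).
    left=> x; rewrite inE; apply/idP/eqP => [/K0 // | ->]; exact: rpred0.
  right=> y; apply/idP/idP => [/Kv // | /asboolP[a ->]].
  by rewrite rpredZ // (v_in _ x).
pose socM : {pred M} := Defs.span (fun x : M =>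
  exists N : submodClosed M, simple_submod N /\ x \in N).
have soc_v : v \in socM.
  apply: mem_span; exists (cyclic_submod v : submodClosed M); split=> //.
  by have := mem_v 1; rewrite scale1r.
have socE x : x \in socM -> exists a, x = a *: v.
  move=> socx; apply: (span_min (P := fun y => exists a, y = a *: v) socx).
  - by exists 0; rewrite scale0r.
  - by move=> a _ _ [b ->] [c ->]; exists (a * b + c); rewrite scalerDl scalerA.
  move=> y [N [[N_neq0 Nmin] Ny]].
  have [y0 | y_neq0] := eqVneq y 0; first by exists 0; rewrite scale0r.
  have Nv := v_in _ _ Ny y_neq0.
  have subN : {subset cyclic_submod v <= N}.
    by move=> z /asboolP[a ->]; exact: rpredZ.
  have [v0 | vN] := Nmin (cyclic_submod v : submodClosed M) subN.
    by have := mem_v 1; rewrite v0 scale1r inE (negPf v_neq0).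
  by move: Ny; rewrite -vN => /asboolP.
exists (Submod soc_v : soc M); split.
  by move=> [x socx]; have [a xa] := socE x socx; exists a; apply: val_inj.
move=> a; split=> [av | av]; first exact: (congr1 val av).
exact: val_inj.
Qed.

(** The image of [g] and the kernel of [f] are complementary, and the first one
    is not zero, so the kernel is. *)
Lemma retract_iso M N (f : M -> N) (g : N -> M) :
    indecomposable_mod M -> linear f -> linear g -> cancel g f ->
  (exists y : N, y != 0) -> mod_iso M N.
Proof.
move=> [_ indecM] lf lg gK [y y_neq0].
have [f' ff'] := linear_witness lf; have [g' gg'] := linear_witness lg.
have f0 : f 0 = 0 by rewrite -ff' raddf0.
have g0 : g 0 = 0 by rewrite -gg' raddf0.
have [A memA] : exists A : submodClosed M, forall x, x \in A <-> x = g (f x).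
  apply: submod_witness => [|a x z fx fz]; first by rewrite f0 g0.
  by rewrite lf lg -fx -fz.
have [B memB] : exists B : submodClosed M, forall x, x \in B <-> f x = 0.
  apply: submod_witness => [|a x z fx fz]; first by rewrite f0.
  by rewrite lf fx fz scaler0 addr0.
have fB x : f (x - g (f x)) = 0.
  by rewrite -ff' raddfB /= !ff' gK subrr.
have [x|x||] := indecM A B.
- exists (g (f x)), (x - g (f x)); split.
  + by apply/memA; rewrite gK.
  + by apply/memB.
  by rewrite addrC subrK.
- by move=> /memA xA /memB xB; rewrite xA xB g0.
- move=> A0; have /memA : g y = g (f (g y)) by rewrite gK.
  by rewrite A0 inE => /eqP gy; case/eqP: y_neq0; rewrite -(gK y) gy f0.
move=> B0; apply: (mod_iso_linear lf); exists g => // x; apply/eqP.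
rewrite eq_sym -subr_eq0; have /memB := fB x.
by rewrite B0 inE.
Qed.

(** The coordinates [h] are those of a section of the surjection onto M from
    a free module that is given by finitely many generators [v]. *)
Lemma dual_basis M : fin_gen M -> projective M ->
  exists (k : nat) (v : 'I_k -> M) (h : 'I_k -> M -> S),
    (forall l, linear (h l : M -> S^o)) /\
    (forall x, x = \sum_(l < k) h l x *: v l).
Proof.
move=> [k [v gen_v]] projM.
have [f fE] : exists f : {linear 'rV[S]_k -> M},
    f =1 fun c => \sum_(l < k) c 0 l *: v l.
  apply: linear_witness => a c d.
  rewrite scaler_sumr -big_split; apply: eq_bigr => l _ /=.
  by rewrite !mxE scalerDl scalerA.
have [x|h hK] := projM _ _ f (idfun : {linear M -> M}).
  have [c ->] := gen_v x; exists (\row_l c l); rewrite fE.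
  by apply: eq_bigr => l _; rewrite mxE.
exists k, v, (fun l x => h x 0 l); split=> [l a x y | x].
  by rewrite linearP !mxE.
by have := hK x; rewrite fE /= => ->.
Qed.

End Modules.

(** * Finiteness, indecomposability and locality criteria *)

Lemma artinian_finite (S : pzRingType) (M : lmodType S) (T : finType)
    (f : T -> M) : (forall x, exists t, x = f t) -> artinian M.
Proof.
move=> f_surj N decN; pose A k := [set t | f t \in N k].
have decA k m : (k <= m)%N -> A m \subset A k.
  move=> /subnK <-; elim: (m - k)%N => // d IHd.
  apply: subset_trans IHd; apply/subsetP => t; rewrite !inE addSn.
  exact: decN.
(* [k] makes the preimage of [N k] as small as possible. *)
have [c /asboolP[k Ak] c_min] :=
  @ex_minnP (fun c => `[< exists k, #|A k| = c >])
    (ex_intro _ #|A 0| (introT (asboolP _) (ex_intro _ 0 erefl))).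
exists k => m le_km x; have [t ->] := f_surj x.
suff /eqP/setP/(_ t) : A m == A k by rewrite !inE.
rewrite eqEcard decA //= Ak c_min //.
by apply/asboolP; exists m.
Qed.

(** A decomposition as a product yields the central idempotent (1, 0). *)
Lemma indecomposable_central (R : pzRingType) :
    (forall z : R, z * z = z -> (forall x, z * x = x * z) ->
      z = 0 \/ z = 1) ->
  indecomposable_ring R.
Proof.
move=> Rz [A [B [f bij_f]]]; case: (bij_f) => g fK gK.
have f_inj := can_inj fK.
have [||z0|z1] := Rz (g (1, 0)).
- by apply: f_inj; rewrite rmorphM /= gK; congr pair; rewrite ?mulr1 ?mulr0.
- move=> x; apply: f_inj; rewrite !rmorphM /= gK.
  by case: (f x) => a b; congr pair => /=; rewrite ?mulr1 ?mul1r ?mulr0 ?mul0r.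
- have := gK (1, 0); rewrite z0 rmorph0 => -[] /eqP.
  by rewrite eq_sym oner_eq0.
have := gK (1, 0); rewrite z1 rmorph1 => -[] /eqP.
by rewrite oner_eq0.
Qed.

(** A left ideal outside which all elements are left invertible contains every
    proper left ideal. *)
Lemma local_ring_left_inverse (T : pzRingType) (P : T -> Prop) :
    P 0 -> (forall a x y, P x -> P y -> P (a * x + y)) -> ~ P 1 ->
    (forall x, ~ P x -> exists y, y * x = 1) ->
  local_ring T.
Proof.
move=> P0 PD P1 Pinv.
have [m mP] := @submod_witness T T^o P P0 PD.
have unit_in (K : submodClosed (T^o : lmodType T)) x :
    x \in K -> ~ P x -> K =i predT.
  move=> Kx /Pinv[y yx] z; rewrite inE.
  have -> : z = (z * y) *: (x : T^o) by rewrite /GRing.scale /= -mulrA yx mulr1.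
  exact: rpredZ.
have m_max : maximal_submod m.
  split=> [mT | K mK]; first by apply/P1/mP; rewrite mT.
  have [Km | /existsNP[x /not_implyP[Kx /mP /(unit_in _ _ Kx)]]] :=
    pselect (forall x, x \in K -> x \in m); last by right.
  by left=> x; apply/idP/idP => [/Km | /mK].
exists m; split=> // m' [m'T m'_max].
have m'm : {subset m' <= m}.
  move=> x m'x; apply/mP; apply: contrapT => nPx; case: m'T.
  exact: unit_in nPx.
have [mm' | mT] := m'_max m m'm; first by move=> x; rewrite mm'.
by case: m_max => /(_ mT).
Qed.

(** * Split basic rings with radical cube zero *)

Section SplitBasic.
Variable k : fieldType.

(** The characters [chi i] are the coordinates of the projection of S onto its
    semisimple quotient k^n, so that their common kernel plays the role of the
    Jacobson radical; max_submod_rad shows that it is the radical. *)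
Record split_basic (S : pzRingType) (n : nat) (e : 'I_n -> S)
    (chi : 'I_n -> S -> k) : Prop := SplitBasic {
  idem_ortho : forall i j, e i * e j = if i == j then e i else 0;
  idem_sum : \sum_i e i = 1;
  charB : forall i, {morph chi i : x y / x - y};
  charM : forall i, {morph chi i : x y / x * y};
  char_idem : forall i j, chi i (e j) = (i == j)%:R;
  char_surj : forall i c, exists x, chi i x = c;
  ker_mul3 : forall x y z, (forall i, chi i x = 0) ->
    (forall i, chi i y = 0) -> (forall i, chi i z = 0) -> x * y * z = 0
}.

(** Gives access to right modules, which are left modules over [S^c]. *)
Lemma split_basic_converse (S : pzRingType) n (e : 'I_n -> S) chi :
  split_basic e chi -> @split_basic S^c n e chi.
Proof.
move=> [e_ortho e_sum chiB chiM chi_e chi_s J3]; split=> //.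
- by move=> i j; rewrite [LHS]e_ortho eq_sym; case: eqP => // ->.
- by move=> i x y; rewrite [LHS]chiM mulrC.
- by move=> x y z x0 y0 z0; rewrite -[RHS](J3 z y x) // -mulrA.
Qed.

Variables (S : pzRingType) (n : nat) (e : 'I_n -> S) (chi : 'I_n -> S -> k).
Hypothesis basicS : split_basic e chi.

Definition rad (x : S) : Prop := forall i, chi i x = 0.

Lemma idem_e i : e i * e i = e i.
Proof. by rewrite (idem_ortho basicS) eqxx. Qed.

Lemma char0 i : chi i 0 = 0.
Proof. by rewrite -[0 in LHS](subrr 0) (charB basicS) subrr. Qed.

Lemma charD i : {morph chi i : x y / x + y}.
Proof.
move=> x y; rewrite -{1}[y]opprK -[- y]sub0r !(charB basicS).
by rewrite char0 sub0r opprK.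
Qed.

Lemma char_sum i I (r : seq I) (F : I -> S) :
  chi i (\sum_(j <- r) F j) = \sum_(j <- r) chi i (F j).
Proof. exact: (big_morph (chi i) (charD i) (char0 i)). Qed.

Lemma char1 i : chi i 1 = 1.
Proof.
rewrite -(idem_sum basicS) char_sum (bigD1 i) //= big1 ?addr0.
  by rewrite (char_idem basicS) eqxx.
by move=> j /negPf; rewrite (char_idem basicS) eq_sym => ->.
Qed.

Lemma char_ei i : chi i (e i) = 1.
Proof. by rewrite (char_idem basicS) eqxx. Qed.

Lemma char_corner i j x : chi j (e i * x * e i) = if j == i then chi i x else 0.
Proof.
rewrite !(charM basicS) !(char_idem basicS).
by case: eqP => [->|]; rewrite ?mul1r ?mulr1 ?mulr0.
Qed.

Lemma rad_mull a x : rad x -> rad (a * x).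
Proof. by move=> x0 i; rewrite (charM basicS) x0 mulr0. Qed.

Lemma rad_cube x : rad x -> x * x * x = 0.
Proof. by move=> x0; exact: (ker_mul3 basicS). Qed.

Lemma rad_mul_idem a i : chi i a = 0 -> rad (a * e i).
Proof.
move=> ai j; rewrite (charM basicS) (char_idem basicS).
by case: eqP => [->|_]; rewrite ?ai ?mul0r ?mulr0.
Qed.

(** Modulo the radical, the corner at [e i] is the field k; an element of the
    corner that is nonzero there is a nilpotent perturbation of the unity up to
    scaling, and the geometric series inverts it. *)
Lemma corner_unit i u : e i * u * e i = u -> chi i u <> 0 ->
  exists u', u' * u = e i /\ e i * u' = u'.
Proof.
set f := e i => ue chiu; have ff : f * f = f := idem_e i.
wlog chiu1 : u ue chiu / chi i u = 1.
  move=> unit1; have [x chix] := char_surj basicS i (chi i u)^-1.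
  have uf : u * f = u by rewrite -ue -!mulrA ff.
  have chi1 : chi i (f * x * u) = 1.
    by rewrite !(charM basicS) chix char_ei mul1r mulVf //; apply/eqP.
  have [|||w [wK fw]] := unit1 (f * x * u) => //.
  - by rewrite !mulrA ff -[LHS]mulrA uf.
  - by rewrite chi1; apply/eqP/oner_neq0.
  by exists (w * (f * x)); rewrite -mulrA wK mulrA fw.
have fu : f * u = u by rewrite -ue !mulrA ff.
have uf : u * f = u by rewrite -ue -!mulrA ff.
pose y := f - u.
have fy : f * y = y by rewrite mulrBr ff fu.
have yf : y * f = y by rewrite mulrBl ff uf.
have y3 : y * y * y = 0.
  apply: rad_cube => j; rewrite -[y]fy -yf mulrA char_corner.
  by rewrite (charB basicS) char_ei chiu1 subrr if_same.
have uE : u = f - y by rewrite opprB addrC subrK.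
clearbody y; exists (f + y + y * y); split.
  by rewrite uE mulrBr !mulrDl ff fy y3 -mulrA yf addr0 -(addrA f) addrK.
by rewrite !mulrDr mulrA ff fy.
Qed.

(** * Principal indecomposable modules of a split basic ring *)

Section LeftPim.
Variable i : 'I_n.

Lemma pim_subproof a : a * e i \in cyclic_submod (e i : left_reg S).
Proof. by apply/asboolP; exists a. Qed.

Definition pim_elt (a : S) : left_pim (e i) := Submod (pim_subproof a).

(** Fixes the type of the underlying element to S itself, instead of the regular
    module, so that the ring operations of S apply to it. *)
Definition pim_val (x : left_pim (e i)) : S := val x.

Lemma pim_valK (x : left_pim (e i)) : pim_val x * e i = pim_val x.
Proof.
case: x => x xe; rewrite /pim_val /=.
by have /asboolP[a ->] := xe; rewrite -[LHS]mulrA idem_e.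
Qed.

Lemma pim_eltK a : pim_val (pim_elt a) = a * e i.
Proof. by []. Qed.

Lemma pim_valZ a x : pim_val (a *: x) = a * pim_val x.
Proof. by []. Qed.

Lemma pim_val_inj : injective pim_val.
Proof. exact: val_inj. Qed.

Lemma pim_cyclic (x : left_pim (e i)) : x = pim_val x *: pim_elt 1.
Proof. by apply: pim_val_inj; rewrite pim_valZ pim_eltK mul1r pim_valK. Qed.

Lemma pim_eltD a x y : pim_elt (a * x + y) = a *: pim_elt x + pim_elt y.
Proof. by apply: pim_val_inj; rewrite [LHS]mulrDl -mulrA. Qed.

(** The class of [e i] generates the top.  An element [a] with [chi i a = 0]
    kills it because [a * e i] is in the radical; conversely [chi i] vanishes on
    the multiples of the radical. *)
Lemma top_cyclic (I : S -> Prop) : (forall x, I x <-> rad x) ->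
  exists v : quot_by I (left_pim (e i)), cyclic_on v (fun a => chi i a = 0).
Proof.
move=> Irad; exists (\pi_(quot_by I (left_pim (e i))) (pim_elt 1)); split.
  move=> v; have [x ->] := quotmod_surj v; exists (pim_val x).
  by rewrite [LHS](congr1 _ (pim_cyclic x)) -pi_quotmodZ.
move=> a; rewrite [_ *: _]pi_quotmodZ.
have pi0 : \pi_(quot_by I (left_pim (e i))) 0 = 0.
  by rewrite -[0 in LHS](subrr 0) pi_quotmodB subrr.
rewrite -[X in _ = X]pi0; split=> [/quotmod_eqP | a0].
  rewrite subr0 => ax.
  have -> : chi i a = chi i (pim_val (a *: pim_elt 1)).
    by rewrite pim_valZ pim_eltK mul1r (charM basicS) char_ei mulr1.
  apply: (span_min (P := fun x => chi i (pim_val x) = 0) ax).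
  - exact: char0.
  - move=> b y z y0 z0.
    have -> : pim_val (b *: y + z) = b * pim_val y + pim_val z by [].
    by rewrite charD (charM basicS) y0 z0 mulr0 addr0.
  move=> _ [b [y [/Irad b0 ->]]].
  by rewrite pim_valZ (charM basicS) b0 mul0r.
apply/quotmod_eqP; rewrite subr0.
apply: mem_span; exists (a * e i), (pim_elt 1); split.
  exact/Irad/rad_mul_idem.
by apply: pim_val_inj; rewrite !pim_valZ pim_eltK mul1r -mulrA idem_e.
Qed.

Lemma pim_soc_cyclic j s :
    s * e i = s -> s != 0 ->
    (forall x, x * e i = x -> x != 0 -> exists a, s = a * x) ->
    (forall a, a * s = 0 <-> chi j a = 0) ->
  exists w : soc (left_pim (e i)), cyclic_on w (fun a => chi j a = 0).
Proof.
move=> se s_neq0 s_ess s_ann; have vals : pim_val (pim_elt s) = s by [].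
have [||w [gen_w ann_w]] := @soc_cyclic _ _ (pim_elt s).
- by apply: contraNneq s_neq0 => s0; rewrite -vals s0.
- move=> x x_neq0; have [||a sa] := s_ess (pim_val x).
  + exact: pim_valK.
  + by apply: contraNneq x_neq0 => x0; apply/eqP/pim_val_inj.
  by exists a; apply: pim_val_inj; rewrite vals.
exists w; split=> // a; rewrite ann_w -s_ann.
split=> [/(congr1 pim_val) | as0]; first by rewrite pim_valZ vals.
by apply: pim_val_inj; rewrite pim_valZ vals.
Qed.

End LeftPim.

(** The image of [e i] under a linear map S(e i) -> S(e j) lies in
    [e i * S * e j], hence in the radical for distinct i and j, so that the map
    misses [e j]. *)
Lemma pim_not_iso i j :
  i != j -> ~ mod_iso (left_pim (e i)) (left_pim (e j)).
Proof.
move=> ij [f [g fK gK]]; set v := pim_val (f (pim_elt i 1)).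
have v_rad : rad v.
  have -> : v = e i * v.
    rewrite /v -pim_valZ -linearZ; congr (pim_val (f _)).
    by apply: pim_val_inj; rewrite pim_valZ pim_eltK mul1r idem_e.
  rewrite -[v]pim_valK mulrA; apply: rad_mul_idem.
  by rewrite (charM basicS) (char_idem basicS) eq_sym (negPf ij) mul0r.
have /(congr1 (fun x => chi j (pim_val x))) := gK (pim_elt j 1).
rewrite pim_eltK mul1r char_ei [g _]pim_cyclic linearZ pim_valZ.
by rewrite (rad_mull _ v_rad) => /esym/eqP; rewrite oner_eq0.
Qed.

(** If all coordinates of a dual basis took values in the radical, expanding
    the coordinates of an element twice would show them to be in the cube of the
    radical, so P would be zero.  A coordinate with a value [h l x] outside the
    radical, where [chi i (h l x)] is nonzero say, gives maps
    P -> S(e i) -> P, the second one sending [e i] to a multiple of [x]; their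
    composite on S(e i) is the identity because that multiple is chosen with
    the inverse of [e i * h l x * e i] in the corner at [e i]. *)
Lemma proj_indec_pim (P : lmodType S) :
    fin_gen P -> projective P -> indecomposable_mod P ->
  exists i, mod_iso P (left_pim (e i)).
Proof.
move=> fgP projP indecP.
have [r [v [h [lin_h hE]]]] := dual_basis fgP projP.
have [x [l [i hx]]] : exists x l i, chi i (h l x) <> 0.
  apply: contrapT => no_x.
  have h_rad l x : rad (h l x).
    by move=> i; apply: contrapT => hx; apply: no_x; exists x, l, i.
  have hM l x : h l x = \sum_m h m x * h l (v m).
    have [h' hh'] := linear_witness (lin_h l).
    rewrite -[LHS]hh' {1}[x]hE linear_sum; apply: eq_bigr => m _.
    by rewrite linearZ /= hh'.
  have [[x x_neq0] _] := indecP; case/eqP: x_neq0.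
  rewrite [x]hE big1 // => l _; rewrite hM big1 ?scale0r // => m _.
  rewrite hM mulr_suml big1 // => p _.
  exact: (ker_mul3 basicS (h_rad _ _) (h_rad _ _) (h_rad _ _)).
exists i.
have hZ a y : h l (a *: y) = a * h l y.
  have [h' hh'] := linear_witness (lin_h l).
  by rewrite -!hh' linearZ.
have [||u' [u'u _]] := @corner_unit i (e i * h l x * e i).
- by rewrite !mulrA idem_e -!mulrA idem_e.
- by rewrite char_corner eqxx.
pose f y := pim_elt i (h l y).
pose g (s : left_pim (e i)) := (pim_val s * u' * e i) *: x.
apply: (@retract_iso _ _ _ f g indecP).
- by move=> a y z; rewrite /f lin_h pim_eltD.
- move=> a s t; rewrite /g.
  have -> : pim_val (a *: s + t) = a * pim_val s + pim_val t by [].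
  by rewrite !mulrDl scalerDl scalerA !mulrA.
- move=> s; apply: pim_val_inj; rewrite pim_eltK hZ -!mulrA.
  have -> : e i * (h l x * e i) = e i * h l x * e i by rewrite mulrA.
  by rewrite u'u pim_valK.
exists (pim_elt i 1); apply/eqP => /(congr1 (fun x => chi i (pim_val x))).
by rewrite pim_eltK mul1r char_ei char0 => /eqP; rewrite oner_eq0.
Qed.

Lemma left_reg_sum :
  mod_iso (left_reg S)
    (dsum (fun i => dsum (fun _ : 'I_1 => left_pim (e i)))).
Proof.
pose D := dsum (fun i => dsum (fun _ : 'I_1 => left_pim (e i))).
pose f (a : left_reg S) : D := [ffun i => [ffun=> pim_elt i a] : dsum _].
apply: (@mod_iso_linear _ _ _ f).
  move=> a x y; apply/ffunP => i; apply/ffunP => j.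
  by rewrite !ffunE pim_eltD.
exists (fun s : D => \sum_i pim_val (s i ord0)) => [a | s].
  rewrite -[RHS]mulr1 -(idem_sum basicS) mulr_sumr.
  by apply: eq_bigr => i _; rewrite !ffunE.
apply/ffunP => i; apply/ffunP => j; rewrite !ffunE (ord1 j).
apply: pim_val_inj; rewrite pim_eltK mulr_suml (bigD1 i) //= pim_valK.
rewrite big1 ?addr0 // => m mi.
by rewrite -pim_valK -mulrA (idem_ortho basicS) (negPf mi) mulr0.
Qed.

Lemma local_idempotent_e i : local_idempotent (e i).
Proof.
exists (idem_e i); set T := corner _.
apply: (@local_ring_left_inverse T (fun x : T => chi i (val x) = 0)).
- exact: char0.
- move=> a x y x0 y0.
  have -> : val (a * x + y) = val a * val x + val y by [].
  by rewrite charD (charM basicS) x0 y0 mulr0 addr0.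
- by rewrite [val _](erefl : _ = e i) char_ei => /eqP; rewrite oner_eq0.
move=> x x1; have [u' [u'x eu']] := corner_unit (corner_valP x) x1.
have u'e : e i * (u' * e i) * e i = u' * e i.
  by rewrite !mulrA eu' -mulrA idem_e.
exists (Corner (idem_e i) (introT eqP u'e)); apply: val_inj => /=.
by rewrite -mulrA corner_mull.
Qed.

Lemma ker_char_max i :
  exists m : submodClosed (left_reg S),
    maximal_submod m /\ (forall x, x \in m <-> chi i x = 0).
Proof.
have [m mP] : exists m : submodClosed (left_reg S),
    forall x, x \in m <-> chi i x = 0.
  apply: submod_witness => [|a x y x0 y0]; first exact: char0.
  by rewrite charD [X in X + _](charM basicS) x0 y0 mulr0 addr0.
exists m; split=> //; split=> [mT | K mK].
  by have /mP/eqP := mT 1; rewrite char1 oner_eq0.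
have [Km | /existsNP[x /not_implyP[Kx /mP x_neq0]]] :=
  pselect (forall x, x \in K -> x \in m).
  by left=> x; apply/idP/idP => [/Km | /mK].
right=> y; rewrite inE; have [b chib] := char_surj basicS i (chi i x)^-1.
have K1 : (1 : left_reg S) \in K.
  rewrite -[1](subrK (b *: x)) rpredD ?rpredZ //; apply/mK/mP.
  rewrite (charB basicS) char1 [X in _ - X](charM basicS) chib.
  by rewrite mulVf ?subrr //; apply/eqP.
by have := rpredZ y K1; rewrite [_ *: _]mulr1.
Qed.

(** The kernels of the characters are maximal, which gives one inclusion.  For
    the other one, a maximal [m] not containing [x] would satisfy
    [1 = a + r * x] with [a] in [m], where [r * x] is nilpotent, so that [a]
    would be a unit. *)
Lemma max_submod_rad (x : S) :
  (forall m : submodClosed (left_reg S), maximal_submod m -> x \in m)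
    <-> rad x.
Proof.
split=> [max_x i | x0 m m_max].
  by have [m [m_max mP]] := ker_char_max i; apply/mP/max_x.
apply: contrapT => mx.
have [K KP] : exists K : submodClosed (left_reg S), forall y, y \in K <->
    exists a r : left_reg S, a \in m /\ y = a + r * x.
  apply: submod_witness => [|b _ _ [a [r [ma ->]]] [a' [r' [ma' ->]]]].
    by exists 0, 0; rewrite rpred0 mul0r addr0.
  exists (b *: a + a'), (b * r + r'); split; first by rewrite rpredD ?rpredZ.
  by rewrite scalerDr mulrDl addrACA [b *: (r * x)]mulrA.
have mK : {subset m <= K}.
  by move=> a ma; apply/KP; exists a, 0; rewrite mul0r addr0.
case: m_max => mT /(_ K mK)[Km | KT].
  by apply: mx; rewrite -Km; apply/KP; exists 0, 1; rewrite rpred0 mul1r add0r.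
have /KP[a [r [ma a_def]]] : (1 : left_reg S) \in K by rewrite KT.
have rx0 := rad_mull r x0; set y := r * x in a_def rx0.
have m1 : (1 : left_reg S) \in m.
  have -> : (1 : left_reg S) = (1 + y + y * y) *: a.
    rewrite [a](_ : _ = 1 - y); last by rewrite [X in X - _]a_def addrK.
    rewrite [RHS]mulrBr mulr1 !mulrDl mul1r (rad_cube rx0) addr0.
    by rewrite -(addrA 1) addrK.
  exact: rpredZ.
by apply: mT => z; have := rpredZ z m1; rewrite [_ *: _]mulr1 inE.
Qed.

End SplitBasic.

(** * The algebra of a permutation *)

(** The components of an element are its coefficients on the vertices, on the
    arrows, and on the paths of length two.  The permutation enters the product;
    it is a parameter of the type so that each permutation has its own ring
    structure. *)
Definition nakayama_alg (k : finFieldType) (n : nat) (pi : 'S_n) : Type :=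
  ({ffun 'I_n -> k} * 'M[k]_n * {ffun 'I_n -> k})%type.

HB.instance Definition _ k n (pi : 'S_n) := Finite.on (nakayama_alg k pi).
HB.instance Definition _ k n (pi : 'S_n) :=
  GRing.Zmodule.on (nakayama_alg k pi).

Section NakayamaAlgebra.
Variables (k : finFieldType) (n : nat) (pi : 'S_n).

Local Notation R := (nakayama_alg k pi).
Implicit Types (x y z : R) (c : k).

Definition vcoef x (i : 'I_n) : k := x.1.1 i.
Definition acoef x (i j : 'I_n) : k := x.1.2 i j.
Definition scoef x (i : 'I_n) : k := x.2 i.

Definition alg_elt (d : 'I_n -> k) (A : 'I_n -> 'I_n -> k)
    (s : 'I_n -> k) : R :=
  ([ffun i => d i], \matrix_(i, j) A i j, [ffun i => s i]).

Lemma vcoefE d A s : vcoef (alg_elt d A s) =1 d.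
Proof. by move=> i; rewrite /vcoef ffunE. Qed.

Lemma acoefE d A s i j : acoef (alg_elt d A s) i j = A i j.
Proof. by rewrite /acoef mxE. Qed.

Lemma scoefE d A s : scoef (alg_elt d A s) =1 s.
Proof. by move=> i; rewrite /scoef ffunE. Qed.

Lemma vcoef0 i : vcoef 0 i = 0. Proof. by rewrite [LHS]ffunE. Qed.
Lemma acoef0 i j : acoef 0 i j = 0. Proof. by rewrite [LHS]mxE. Qed.
Lemma scoef0 i : scoef 0 i = 0. Proof. by rewrite [LHS]ffunE. Qed.

Lemma vcoefD x y i : vcoef (x + y) i = vcoef x i + vcoef y i.
Proof. by rewrite [LHS]ffunE. Qed.
Lemma acoefD x y i j : acoef (x + y) i j = acoef x i j + acoef y i j.
Proof. by rewrite [LHS]mxE. Qed.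
Lemma scoefD x y i : scoef (x + y) i = scoef x i + scoef y i.
Proof. by rewrite [LHS]ffunE. Qed.

Lemma vcoefB x y i : vcoef (x - y) i = vcoef x i - vcoef y i.
Proof. by apply: (addIr (vcoef y i)); rewrite -vcoefD !subrK. Qed.

Lemma alg_eqP x y : vcoef x =1 vcoef y -> acoef x =2 acoef y ->
  scoef x =1 scoef y -> x = y.
Proof.
case: x y => [[d A] s] [[d' A'] s'] dd' AA' ss'.
by congr (_, _, _); [apply/ffunP | apply/matrixP | apply/ffunP].
Qed.

Lemma alg_eq0 x : (forall i, vcoef x i = 0) ->
  (forall i j, acoef x i j = 0) -> (forall i, scoef x i = 0) -> x = 0.
Proof.
move=> x0 A0 s0.
by apply: alg_eqP => [i|i j|i]; rewrite ?(vcoef0, acoef0, scoef0).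
Qed.

Definition alg_one : R := alg_elt (fun=> 1) (fun _ _ => 0) (fun=> 0).

(** The last component is where the permutation acts: the path s_i starts at i
    and ends at pi(i), and it is the value of every path i -> j -> pi(i). *)
Definition alg_mul x y : R := alg_elt
  (fun i => vcoef x i * vcoef y i)
  (fun i j => vcoef x i * acoef y i j + acoef x i j * vcoef y j)
  (fun i => vcoef x i * scoef y i + scoef x i * vcoef y (pi i)
            + \sum_j acoef x i j * acoef y j (pi i)).

Lemma alg_mulA : associative alg_mul.
Proof.
move=> x y z; apply: alg_eqP => [i|i j|i].
- by rewrite !vcoefE mulrA.
- by rewrite !(vcoefE, acoefE) mulrDr mulrDl !mulrA addrA.
rewrite !(vcoefE, scoefE) !mulrDr !mulrDl !mulrA mulr_sumr mulr_suml.
have -> : \sum_j acoef x i j * acoef (alg_mul y z) j (pi i)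
    = \sum_j acoef x i j * vcoef y j * acoef z j (pi i)
      + \sum_j acoef x i j * acoef y j (pi i) * vcoef z (pi i).
  by rewrite -big_split; apply: eq_bigr => j _ /=; rewrite acoefE mulrDr !mulrA.
have -> : \sum_j acoef (alg_mul x y) i j * acoef z j (pi i)
    = \sum_j vcoef x i * (acoef y i j * acoef z j (pi i))
      + \sum_j acoef x i j * vcoef y j * acoef z j (pi i).
  by rewrite -big_split; apply: eq_bigr => j _ /=; rewrite acoefE mulrDl !mulrA.
rewrite -!addrA; do 2!congr (_ + _).
by rewrite addrCA; congr (_ + _); rewrite addrA [RHS]addrC.
Qed.

Lemma alg_mul1 : left_id alg_one alg_mul.
Proof.
move=> x; apply: alg_eqP => [i|i j|i]; rewrite !(vcoefE, acoefE, scoefE).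
- exact: mul1r.
- by rewrite mul1r mul0r addr0.
by rewrite mul1r mul0r addr0 big1 ?addr0 // => j _; rewrite acoefE mul0r.
Qed.

Lemma alg_mulr1 : right_id alg_one alg_mul.
Proof.
move=> x; apply: alg_eqP => [i|i j|i]; rewrite !(vcoefE, acoefE, scoefE).
- exact: mulr1.
- by rewrite mulr1 mulr0 add0r.
by rewrite mulr1 mulr0 add0r big1 ?addr0 // => j _; rewrite acoefE mulr0.
Qed.

Lemma alg_mulDl : left_distributive alg_mul +%R.
Proof.
move=> x y z; apply: alg_eqP => [i|i j|i];
  rewrite !(vcoefD, acoefD, scoefD, vcoefE, acoefE, scoefE) !mulrDl //.
  exact: addrACA.
rewrite [in RHS]addrACA -big_split /=; congr (_ + _); first exact: addrACA.
by apply: eq_bigr => j _; rewrite acoefD mulrDl.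
Qed.

Lemma alg_mulDr : right_distributive alg_mul +%R.
Proof.
move=> x y z; apply: alg_eqP => [i|i j|i];
  rewrite !(vcoefD, acoefD, scoefD, vcoefE, acoefE, scoefE) !mulrDr //.
  exact: addrACA.
rewrite [in RHS]addrACA -big_split /=; congr (_ + _); first exact: addrACA.
by apply: eq_bigr => j _; rewrite acoefD mulrDr.
Qed.

HB.instance Definition _ := GRing.Zmodule_isPzRing.Build R
  alg_mulA alg_mul1 alg_mulr1 alg_mulDl alg_mulDr.

Lemma vcoef1 i : vcoef 1 i = 1.
Proof. exact: vcoefE. Qed.
Lemma acoef1 i j : acoef 1 i j = 0.
Proof. exact: acoefE. Qed.
Lemma scoef1 i : scoef 1 i = 0.
Proof. exact: scoefE. Qed.

Lemma vcoefM x y i : vcoef (x * y) i = vcoef x i * vcoef y i.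
Proof. exact: vcoefE. Qed.
Lemma acoefM x y i j :
  acoef (x * y) i j = vcoef x i * acoef y i j + acoef x i j * vcoef y j.
Proof. exact: acoefE. Qed.
Lemma scoefM x y i :
  scoef (x * y) i = vcoef x i * scoef y i + scoef x i * vcoef y (pi i)
                    + \sum_j acoef x i j * acoef y j (pi i).
Proof. exact: scoefE. Qed.

Definition vert (i : 'I_n) c : R :=
  alg_elt (fun p => c *+ (p == i)) (fun _ _ => 0) (fun=> 0).
Definition arrow (i j : 'I_n) c : R :=
  alg_elt (fun=> 0) (fun p q => c *+ ((p == i) && (q == j))) (fun=> 0).
Definition socle (i : 'I_n) c : R :=
  alg_elt (fun=> 0) (fun _ _ => 0) (fun p => c *+ (p == i)).

Definition coefE := (vcoefE, acoefE, scoefE, vcoef1, acoef1, scoef1,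
  vcoefM, acoefM, scoefM, mul0r, mulr0, add0r, addr0, mulr1, mul1r).

Lemma vcoef_sum I (r : seq I) (G : I -> R) i :
  vcoef (\sum_(j <- r) G j) i = \sum_(j <- r) vcoef (G j) i.
Proof. exact: (big_morph (vcoef^~ i) (fun x y => vcoefD x y i) (vcoef0 i)). Qed.

Lemma acoef_sum I (r : seq I) (G : I -> R) i p :
  acoef (\sum_(j <- r) G j) i p = \sum_(j <- r) acoef (G j) i p.
Proof.
apply: (big_morph (fun x => acoef x i p)); last exact: acoef0.
by move=> x y; exact: acoefD.
Qed.

Lemma scoef_sum I (r : seq I) (G : I -> R) i :
  scoef (\sum_(j <- r) G j) i = \sum_(j <- r) scoef (G j) i.
Proof. exact: (big_morph (scoef^~ i) (fun x y => scoefD x y i) (scoef0 i)). Qed.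

Definition chi (i : 'I_n) x : k := vcoef x i.

Definition idem (i : 'I_n) : R := vert i 1.

Lemma idem_mul_idem i j : idem i * idem j = if i == j then idem i else 0.
Proof.
case: eqP => [<-|/eqP ij].
  apply: alg_eqP => [p|p q|p]; rewrite !coefE //.
    by case: eqP; rewrite ?mulr0n ?mulr0 ?mulr1.
  by rewrite big1 // => m _; rewrite !coefE.
apply: alg_eq0 => [p|p q|p]; rewrite !coefE //.
  by case: eqP => [->|_]; rewrite ?(negPf ij) ?mulr0n ?mulr0 ?mul0r.
by rewrite big1 // => m _; rewrite !coefE.
Qed.

Lemma sum_idem : \sum_i idem i = 1.
Proof.
apply: alg_eqP => [p|p q|p]; rewrite ?(vcoef_sum, acoef_sum, scoef_sum) coefE.
- rewrite (bigD1 p) //= vcoefE eqxx big1 ?addr0 // => m mp.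
  by rewrite vcoefE eq_sym (negPf mp).
- by rewrite big1 // => m _; rewrite acoefE.
by rewrite big1 // => m _; rewrite scoefE.
Qed.

Lemma mul3_eq0 x y z : (forall i, vcoef x i = 0) ->
  (forall i, vcoef y i = 0) -> (forall i, vcoef z i = 0) -> x * y * z = 0.
Proof.
move=> x0 y0 z0.
apply: alg_eq0 => [p|p q|p]; rewrite !coefE ?x0 ?y0 ?z0 !coefE //.
by rewrite big1 // => m _; rewrite !coefE x0 y0 !coefE.
Qed.

Lemma nakayama_alg_basic : split_basic idem chi.
Proof.
split.
- exact: idem_mul_idem.
- exact: sum_idem.
- by move=> i x y; exact: vcoefB.
- by move=> i x y; exact: vcoefM.
- by move=> i j; rewrite /chi vcoefE.
- by move=> i c; exists (vert i c); rewrite /chi vcoefE eqxx.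
exact: mul3_eq0.
Qed.

Lemma idem_mul_socle i : idem i * socle i 1 = socle i 1.
Proof.
apply: alg_eqP => [p|p q|p]; rewrite !coefE //.
rewrite big1 => [|m _]; last by rewrite !coefE.
by case: eqP; rewrite ?mulr0n ?mul0r ?mulr1 ?addr0.
Qed.

Lemma socle_mul_idem i : socle i 1 * idem (pi i) = socle i 1.
Proof.
apply: alg_eqP => [p|p q|p]; rewrite !coefE //.
rewrite big1 => [|m _]; last by rewrite !coefE.
by rewrite (inj_eq perm_inj); case: eqP; rewrite ?mulr0n ?mul0r ?mulr1 ?addr0.
Qed.

Lemma socle_neq0 i : socle i 1 != 0.
Proof.
apply/eqP => /(congr1 (fun x => scoef x i)); rewrite scoefE eqxx scoef0.
by apply/eqP/oner_neq0.
Qed.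

Lemma socle_mul_eq0 i x : socle i 1 * x = 0 <-> vcoef x (pi i) = 0.
Proof.
have sxE p : scoef (socle i 1 * x) p = vcoef x (pi p) *+ (p == i).
  rewrite !coefE big1 ?addr0 ?mulr_natl // => m _.
  by rewrite !coefE.
split=> [sx0 | x0].
  by have := sxE i; rewrite sx0 scoef0 eqxx mulr1n => <-.
apply: alg_eq0 => [p|p q|p]; rewrite ?sxE; try by rewrite !coefE.
by case: eqP => [->|_]; rewrite ?x0.
Qed.

Lemma mul_socle_eq0 i x : x * socle i 1 = 0 <-> vcoef x i = 0.
Proof.
have xsE p : scoef (x * socle i 1) p = vcoef x p *+ (p == i).
  rewrite !coefE big1 ?addr0 ?mulr_natr // => m _.
  by rewrite !coefE.
split=> [xs0 | x0].
  by have := xsE i; rewrite xs0 scoef0 eqxx mulr1n => <-.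
apply: alg_eq0 => [p|p q|p]; rewrite ?xsE; try by rewrite !coefE.
by case: eqP => [->|_]; rewrite ?x0.
Qed.

(** A nonzero coefficient of [x] on a path of smallest length is moved to s_i by
    the path that completes it: s_i itself for the vertex i, the arrow
    j -> pi(i) for an arrow i -> j, and the vertex pi(i) for s_i. *)
Lemma socle_essential_right i x :
  idem i * x = x -> x != 0 -> exists a, socle i 1 = x * a.
Proof.
move=> ex x_neq0.
have xv p : p != i -> vcoef x p = 0.
  by move=> /negPf pNi; rewrite -ex !coefE pNi mulr0n mul0r.
have xa p q : p != i -> acoef x p q = 0.
  by move=> /negPf pNi; rewrite -ex !coefE pNi mulr0n mul0r.
have xs p : p != i -> scoef x p = 0.
  move=> /negPf pNi; rewrite -ex !coefE pNi mulr0n mul0r add0r big1 // => m _.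
  by rewrite !coefE.
have [xi0 | xi_neq0] := eqVneq (vcoef x i) 0; last first.
  exists (socle i (vcoef x i)^-1).
  apply: alg_eqP => [p|p q|p]; rewrite !coefE //.
  rewrite big1 => [|m _]; last by rewrite !coefE.
  by case: eqP => [->|_]; rewrite ?mulr0n ?mulr0 ?addr0 ?divff.
have xv0 p : vcoef x p = 0 by have [->|/xv] := eqVneq p i.
have [xA0 | /existsNP[j /eqP xj_neq0]] := pselect (forall j, acoef x i j = 0).
  have xA p q : acoef x p q = 0 by have [->|/xa] := eqVneq p i.
  have xs_neq0 : scoef x i != 0.
    apply: contraNneq x_neq0 => xs0; apply/eqP/alg_eq0 => // p.
    by have [->|/xs] := eqVneq p i.
  exists (vert (pi i) (scoef x i)^-1); apply: alg_eqP => [p|p q|p].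
  - by rewrite !coefE xv0 !coefE.
  - by rewrite !coefE xA !coefE.
  rewrite !coefE big1 => [|m _]; last by rewrite !coefE.
  rewrite (inj_eq perm_inj).
  by case: eqP => [->|_]; rewrite ?mulr0n ?mulr0 ?addr0 ?divff.
exists (arrow j (pi i) (acoef x i j)^-1).
apply: alg_eqP => [p|p q|p]; rewrite !(coefE, xv0) //.
rewrite (bigD1 j) //= acoefE eqxx (inj_eq perm_inj) big1 => [|m mj].
  by case: eqP => [->|_]; rewrite ?mulr0n ?mulr0 ?addr0 ?divff.
by rewrite acoefE (negPf mj) mulr0.
Qed.

(** As on the right side; an arrow j -> pi(i) is now completed by i -> j on its
    left. *)
Lemma socle_essential_left i x :
  x * idem (pi i) = x -> x != 0 -> exists a, socle i 1 = a * x.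
Proof.
move=> xe x_neq0.
have xv p : p != pi i -> vcoef x p = 0.
  by move=> /negPf pNi; rewrite -xe !coefE pNi mulr0n mulr0.
have xa p q : q != pi i -> acoef x p q = 0.
  by move=> /negPf qNi; rewrite -xe !coefE qNi mulr0n mulr0.
have xs p : p != i -> scoef x p = 0.
  move=> /negPf pNi; rewrite -xe !coefE (inj_eq perm_inj) pNi mulr0n mulr0.
  by rewrite add0r big1 // => m _; rewrite !coefE.
have [xi0 | xi_neq0] := eqVneq (vcoef x (pi i)) 0; last first.
  exists (socle i (vcoef x (pi i))^-1).
  apply: alg_eqP => [p|p q|p]; rewrite !coefE //.
  rewrite big1 => [|m _]; last by rewrite !coefE.
  by case: eqP => [->|_]; rewrite ?mulr0n ?mul0r ?addr0 ?mulVf.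
have xv0 p : vcoef x p = 0 by have [->|/xv] := eqVneq p (pi i).
have [xA0 | /existsNP[j /eqP xj_neq0]] :=
  pselect (forall j, acoef x j (pi i) = 0).
  have xA p q : acoef x p q = 0 by have [->|/xa] := eqVneq q (pi i).
  have xs_neq0 : scoef x i != 0.
    apply: contraNneq x_neq0 => xs0; apply/eqP/alg_eq0 => // p.
    by have [->|/xs] := eqVneq p i.
  exists (vert i (scoef x i)^-1); apply: alg_eqP => [p|p q|p].
  - by rewrite !coefE xv0 !coefE.
  - by rewrite !coefE xA !coefE.
  rewrite !coefE big1 => [|m _]; last by rewrite !coefE.
  by case: eqP => [->|_]; rewrite ?mulr0n ?mul0r ?addr0 ?mulVf.
exists (arrow i j (acoef x j (pi i))^-1).
apply: alg_eqP => [p|p q|p]; rewrite !(coefE, xv0) //.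
rewrite (bigD1 j) //= acoefE eqxx andbT big1 => [|m mj].
  by case: eqP => [->|_]; rewrite ?mulr0n ?mul0r ?addr0 ?mulVf.
by rewrite acoefE (negPf mj) andbF mul0r.
Qed.

(** Commuting with the arrow i -> j forces a central [z] to have the same
    coefficient at the vertices i and j.  For an idempotent this common
    coefficient is 0 or 1, so [z] or [1 - z] is a nilpotent idempotent. *)
Lemma nakayama_alg_indecomposable : (0 < n)%N -> indecomposable_ring R.
Proof.
move=> n_gt0; apply: indecomposable_central => z zz zC.
have z_const i j : vcoef z i = vcoef z j.
  have /(congr1 (fun x => acoef x i j)) := zC (arrow i j 1).
  by rewrite !coefE !eqxx !mulr1n mulr1 mul1r.
have idem_rad x : x * x = x -> (forall i, vcoef x i = 0) -> x = 0.
  by move=> xx x0; rewrite -(rad_cube nakayama_alg_basic x0) !xx.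
pose i0 := Ordinal n_gt0.
have : vcoef z i0 * (1 - vcoef z i0) = 0.
  by rewrite mulrBr mulr1 -vcoefM zz subrr.
move=> /eqP; rewrite mulf_eq0 subr_eq0 => /orP[/eqP z0 | /eqP z1].
  by left; apply: idem_rad => // i; rewrite (z_const i i0).
right; apply/eqP; rewrite eq_sym -subr_eq0; apply/eqP/idem_rad => [|i].
  by rewrite mulrBl mul1r mulrBr mulr1 zz subrr subr0.
by rewrite vcoefB (z_const i i0) -z1 vcoef1 subrr.
Qed.

Lemma nakayama_alg_Frobenius : Frobenius_with R pi.
Proof.
have basicR := nakayama_alg_basic; have basicRc := split_basic_converse basicR.
have jacobson_rad x : jacobson x <-> rad chi x := max_submod_rad basicRc x.
have local_e := local_idempotent_e basicR.
have ortho_e : orthogonal_family idem.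
  by move=> i j /negPf ij; rewrite (idem_ortho basicR) ij.
exists idem; split.
  split.
  - by apply: (@artinian_finite R (left_reg R) R (fun x => x)) => x; exists x.
  - apply: (@artinian_finite R^c (right_reg R) R (fun x => x)) => x.
    by exists x.
  - by exists n, idem; split=> //; exact: idem_sum basicR.
  - split=> //; first exact: (pim_not_iso basicRc).
    exact: (proj_indec_pim basicRc).
  move=> i; split.
    have [w cyc_w] := pim_soc_cyclic basicRc (idem_mul_socle i)
      (socle_neq0 i) (@socle_essential_right i) (socle_mul_eq0 i).
    have [v cyc_v] := top_cyclic basicRc (pi i) jacobson_rad.
    exact: cyclic_on_iso cyc_w cyc_v.
  have [w cyc_w] := pim_soc_cyclic basicR (socle_mul_idem i)
      (socle_neq0 i) (@socle_essential_left i) (mul_socle_eq0 i).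
  have [v cyc_v] := top_cyclic basicR i jacobson_rad.
  exact: cyclic_on_iso cyc_w cyc_v.
exists (fun=> 1%N); split=> //; split=> //.
exact: (left_reg_sum basicRc).
Qed.

End NakayamaAlgebra.

Theorem corollary27 (n : nat) (pi : 'S_n) (n_gt0 : (0 < n)%N) :
  exists R : pzRingType, indecomposable_ring R /\ Frobenius_with R pi.
Proof.
exists (nakayama_alg 'F_2 pi); split.
  exact: nakayama_alg_indecomposable.
exact: nakayama_alg_Frobenius.
Qed.
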